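(* Consider the coupled model and actual system with model state $X_t$, actual-system state $\hat X_t$, model observation $Y_t$ and control $U_t$, as described in the context. For any control strategy $\mathbf{g}\in\mathcal{G}$ derived offline using the model of the system, the information state $$\Pi_t(Y_{0:t},U_{0:t-1})(X_t,\hat X_t)=p(X_t,\hat X_t\mid Y_{0:t},U_{0:t-1})$$ does not depend on the control strategy $\mathbf{g}$. Moreover, there is a function $\phi_t$, which does not depend on the control strategy $\mathbf{g}$, such that $$\Pi_{t+1}(Y_{0:t+1},U_{0:t})(X_{t+1},\hat X_{t+1})=\phi_t\big[\Pi_t(Y_{0:t},U_{0:t-1})(X_t,\hat X_t),\,Y_{t+1},\,U_t\big],$$ for all $t=0,1,\ldots,T-1$.
   Context: Fix a horizon $T\in\mathbb{N}$ and a probability space $(\Omega,\mathscr{F},\mathbb{P})$. All random variables below are defined on it. For each $t$, $(\mathcal{X}_t,\mathscr{X}_t)$ is the measurable state space and $(\mathcal{U}_t,\mathscr{U}_t)$ is the measurable space of feasible actions, with $\mathcal{U}_t$ nonempty. The disturbances $W_t$, the sensor noises $Z_t$ and the observations take values in measurable spaces $(\mathcal{W},\mathscr{W})$, $(\mathcal{Z},\mathscr{Z})$ and $(\mathcal{Y},\mathscr{Y})$, respectively. The model state $X_t$ and the actual-system state $\hat X_t$ (both $\mathcal{X}_t$-valued) start at the same initial state $X_0$ (so $\hat X_0=X_0$). They are driven by the same control $U_t$ and the same disturbance $W_t$: $$X_{t+1}=f_t(X_t,U_t,W_t),\qquad \hat X_{t+1}=\hat f_t(\hat X_t,U_t,W_t),\qquad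 t=0,\ldots,T-1.$$ The model observation is $Y_t=h_t(X_t,Z_t)$ and the observation of the actual system is $\hat Y_t=h_t(\hat X_t,Z_t)$, for $t=0,\ldots,T$. The $W_t$ are mutually independent and independent of $X_0$. The $Z_t$ are mutually independent and independent of $\{W_t\}$ and of $X_0$. Notation: $Y_{0:t}=(Y_0,\ldots,Y_t)$ and $U_{0:t}=(U_0,\ldots,U_t)$ ($U_{0:-1}$ is empty). A control strategy derived offline using the model is $\mathbf{g}=\{g_t;\ t=0,\ldots,T-1\}$, with each $g_t$ measurable, yielding $U_t=g_t(Y_{0:t},U_{0:t-1})$. $\mathcal{G}$ is the feasible set of strategies. As a convention, all (conditional) probability distributions are represented by densities, written $p$. A superscript, as in $p^{\mathbf{g}}$, indicates dependence on the strategy. ''Does not depend on $\mathbf{g}$'' means that the conditional density given the observation and action history is the same function of that history for every strategy. The information state $\Pi_t$ is the entire conditional density of $(X_t,\hat X_t)$ given $(Y_{0:t},U_{0:t-1})$, not its value at a particular realization of $(X_t,\hat X_t)$. So $\phi_t$ maps a density, an observation and an action to a density. *)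

(* Defs.v *)
From HB Require Import structures.
From mathcomp Require Import all_boot all_order all_algebra.
From mathcomp Require Import all_classical all_reals all_analysis.

Set Implicit Arguments.
Unset Strict Implicit.
Unset Printing Implicit Defensive.

Import Order.TTheory GRing.Theory Num.Theory.
Import numFieldNormedType.Exports.

Local Open Scope classical_set_scope.
Local Open Scope ring_scope.
Local Open Scope ereal_scope.

(* Processes are indexed by nat. For a horizon T only X_0..X_T, U_0..U_(T-1),
   W_0..W_(T-1), Z_0..Z_T and Y_0..Y_T are meaningful: hypotheses and
   conclusions carry the corresponding bound on the time index. The carrier of
   a measurableType is pointed, hence nonempty. *)

(* [hist Y U t] is the space of (y_{0:t}, u_{0:t-1}), stored in order of
   arrival: ((..((y_0, u_0), y_1)..), u_{t-1}), y_t); its sigma-algebra is the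
   product one. *)
Fixpoint hist_display (dY : measure_display) (dU : nat -> measure_display)
    (t : nat) : measure_display :=
  if t is s.+1
  then ((hist_display dY dU s, dU s).-prod, dY).-prod%mdisp else dY.

Fixpoint hist (dY : measure_display) (Y : measurableType dY)
    (dU : nat -> measure_display) (U : forall t, measurableType (dU t))
    (t : nat) : measurableType (hist_display dY dU t) :=
  if t is s.+1 return measurableType (hist_display dY dU t)
  then (hist Y U s * U s * Y)%type : measurableType _ else Y.

Section coupled_system.
Context (dX : nat -> measure_display) (X : forall t, measurableType (dX t)).
Context (dU : nat -> measure_display) (U : forall t, measurableType (dU t)).
Context (dY : measure_display) (Y : measurableType dY).
Context (WT ZT : Type).

Definition strategy := forall t, hist Y U t -> U t.

Definition measurable_strategy (T : nat) (g : strategy) : Prop :=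
  forall t, (t < T)%N -> measurable_fun [set: hist Y U t] (g t).

Context (f fhat : forall t, X t -> U t -> WT -> X t.+1).
Context (h : forall t, X t -> ZT -> Y).

(* ((X_t, Xhat_t), (Y_{0:t}, U_{0:t-1})) along a realization of the noises.
   The strategy is fed with the observations of the model only. *)
Fixpoint trajectory (g : strategy) (x0 : X 0%N) (w : nat -> WT) (z : nat -> ZT)
    (t : nat) : (X t * X t) * hist Y U t :=
  match t return (X t * X t) * hist Y U t with
  | 0%N => ((x0, x0), h x0 (z 0%N))
  | s.+1 =>
      let: ((x, xhat), k) := trajectory g x0 w z s in
      let u := g s k in
      let x' := f x u (w s) in
      let xhat' := fhat xhat u (w s) in
      ((x', xhat'), (k, u, h x' (z s.+1)))
  end.

Context (Omega : Type).
Context (X0 : Omega -> X 0%N) (W : nat -> Omega -> WT) (Z : nat -> Omega -> ZT).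

Definition states (g : strategy) (t : nat) (o : Omega) : X t * X t :=
  (trajectory g (X0 o) (W ^~ o) (Z ^~ o) t).1.

Definition history (g : strategy) (t : nat) (o : Omega) : hist Y U t :=
  (trajectory g (X0 o) (W ^~ o) (Z ^~ o) t).2.

End coupled_system.

(* Mutual independence of a family of set systems (here, of sigma-algebras):
   the product rule holds for every finite subfamily. *)
Definition mutually_independent (d : measure_display) (Omega : measurableType d)
    (R : realType) (P : probability Omega R) (I : choiceType)
    (E : I -> set (set Omega)) : Prop :=
  forall (J : seq I) (A : I -> set Omega), uniq J ->
    (forall i, i \in J -> E i (A i)) ->
    P (\bigcap_(i in [set` J]) A i) = \prod_(i <- J) P (A i).

(* The sigma-algebras generated by the primitive random variables X_0 (index
   None), W_0..W_(T-1) (left summand) and Z_0..Z_T (right summand). *)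
Definition primitive_sigma (d dX0 dW dZ : measure_display)
    (Omega : measurableType d) (X0T : measurableType dX0)
    (WT : measurableType dW) (ZT : measurableType dZ)
    (T : nat) (X0 : Omega -> X0T) (W : nat -> Omega -> WT)
    (Z : nat -> Omega -> ZT) (i : option ('I_T + 'I_T.+1)) : set (set Omega) :=
  match i with
  | None => preimage_set_system setT X0 measurable
  | Some (inl t) => preimage_set_system setT (W t) measurable
  | Some (inr t) => preimage_set_system setT (Z t) measurable
  end.
Arguments primitive_sigma {d dX0 dW dZ Omega X0T WT ZT} T X0 W Z i.

Section densities.
Context (R : realType).

Definition is_density (d : measure_display) (E : measurableType d)
    (mu : {sigma_finite_measure set E -> \bar R}) (p : E -> R) : Prop :=
  [/\ measurable_fun [set: E] p,
      forall x, (0 <= p x)%R &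
      \int[mu]_x (p x)%:E = 1].

Definition density_kernel (dF d : measure_display) (F : measurableType dF)
    (E : measurableType d) (mu : {sigma_finite_measure set E -> \bar R})
    (q : F -> E -> R) : Prop :=
  measurable_fun [set: F * E] (fun a : F * E => q a.1 a.2) /\
  forall y, is_density mu (q y).

Context (d0 : measure_display) (Omega : measurableType d0).
Context (P : probability Omega R).

Definition has_density (d : measure_display) (E : measurableType d)
    (mu : {sigma_finite_measure set E -> \bar R}) (S : Omega -> E) : Prop :=
  exists p : E -> R, is_density mu p /\
    forall A, measurable A -> P (S @^-1` A) = \int[mu]_(x in A) (p x)%:E.

(* The law of S_y has density q y with respect to mu for each parameter y, with
   q jointly measurable. *)
Definition has_density_kernel (dF d : measure_display) (F : measurableType dF)
    (E : measurableType d) (mu : {sigma_finite_measure set E -> \bar R})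
    (S : F -> Omega -> E) : Prop :=
  exists q : F -> E -> R, density_kernel mu q /\
    forall y A, measurable A ->
      P (S y @^-1` A) = \int[mu]_(x in A) (q y x)%:E.

(* q is a (regular) version of the conditional density of S given H. *)
Definition is_conditional_density (dF d : measure_display)
    (F : measurableType dF) (E : measurableType d)
    (mu : {sigma_finite_measure set E -> \bar R})
    (S : Omega -> E) (H : Omega -> F) (q : F -> E -> R) : Prop :=
  density_kernel mu q /\
  forall A B, measurable A -> measurable B ->
    P (S @^-1` A `&` H @^-1` B) =
    \int[P]_(o in H @^-1` B) \int[mu]_(x in A) (q (H o) x)%:E.

End densities.

(* Main.v *)
Require Import Defs.
From HB Require Import structures.
From mathcomp Require Import all_boot all_order all_algebra.
From mathcomp Require Import all_classical all_reals all_analysis.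
From mathcomp Require Import measurable_realfun.

Set Implicit Arguments.
Unset Strict Implicit.
Unset Printing Implicit Defensive.

Import Order.TTheory GRing.Theory Num.Theory.
Import numFieldNormedType.Exports.

Local Open Scope classical_set_scope.
Local Open Scope ring_scope.
Local Open Scope ereal_scope.

(** The conditional density can be computed recursively because each step of the
    system uses noises that the past has not touched. Between two observations
    the pair of states moves under a disturbance independent of the pair and of
    the history, so its conditional density becomes the mixture of the
    transition densities weighted by the current one ([predict]). The next
    observation is then produced by a sensor noise independent of everything so
    far, so Bayes' rule multiplies by the likelihood of the observation and
    normalizes ([bayes]). The action is a function of the history: on a given
    history it enters as a known parameter, and which strategy produced it is
    irrelevant. Hence [filter_update], the composite of the two operations, and
    its iterates [information_state] involve the transition and observation
    densities only. A strategy changes the law of the history, not the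
    conditional density attached to each history.

    Two points need care. First, the normalizing factor of Bayes' rule can be
    zero or infinite. In these cases [bayes] returns the prior, so that every
    history gets a density. This is harmless ([integral_bayes]): for each prior
    an infinite factor occurs only on a null set of observations, and where the
    factor vanishes the joint density vanishes almost everywhere too.

    Second, only independence of the primitive random variables is given, while
    each step needs the next noise to be independent of the whole trajectory.
    The induction therefore carries, along with the conditional density, the
    independence of the trajectory from every finite family of noises that it
    has not used ([independent_of_unused]). Adjoining a fresh noise preserves
    this property, because a measure on a product is determined by its
    rectangles ([independent_of_unused_adjoin]). The induction itself is
    [trajectory_invariant]; it uses conditional densities in the form
    [disintegrates], an identity between integrals of test functions, which
    composes by Tonelli's theorem. *)

(** * Independence of a growing family of noises *)

Lemma measure_eq_rectangles (R : realType) (d1 d2 : measure_display)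
    (E1 : measurableType d1) (E2 : measurableType d2)
    (m1 m2 : {measure set (E1 * E2) -> \bar R}) :
  m1 setT < +oo ->
  (forall A B, measurable A -> measurable B -> m1 (A `*` B) = m2 (A `*` B)) ->
  forall C, measurable C -> m1 C = m2 C.
Proof.
move=> m1_fin m12 C mC.
pose rect := [set A `*` B | A in @measurable d1 E1 & B in @measurable d2 E2].
apply: (measure_unique rect (fun=> setT)) => //.
- exact: measurable_prod_measurableType.
- move=> _ _ [A1 mA1 [B1 mB1 <-]] [A2 mA2 [B2 mB2 <-]].
  exists (A1 `&` A2); first exact: measurableI.
  exists (B1 `&` B2); first exact: measurableI.
  by rewrite setXI.
- by move=> _; exists setT => //; exists setT => //; rewrite setXTT.
- by apply/seteqP; split=> // x _; exists 0%N.
- by move=> _ [A mA [B mB <-]]; exact: m12.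
Qed.

Section independence.
Context (R : realType) (d : measure_display) (Omega : measurableType d).
Context (P : probability Omega R).

Section relative.
Context (I : choiceType) (E : I -> set (set Omega)).

(** [used i] marks the indices that [V] may depend on. The remaining ones enter
    as a whole finite family, rather than one at a time, because adjoining an
    unused noise to [V] consumes one member of the family. *)
Definition independent_of_unused (dF : measure_display) (F : measurableType dF)
    (V : Omega -> F) (used : pred I) : Prop :=
  forall (J : seq I) (A : I -> set Omega) C, uniq J ->
    (forall i, i \in J -> ~~ used i /\ E i (A i)) -> measurable C ->
    P (V @^-1` C `&` \bigcap_(i in [set` J]) A i) =
    P (V @^-1` C) * \prod_(i <- J) P (A i).

Hypothesis mE : forall i A, E i A -> measurable A.

Lemma independent_of_unused_init (dF : measure_display) (F : measurableType dF)
    (V : Omega -> F) (i : I) :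
  mutually_independent P E -> E i = preimage_set_system setT V measurable ->
  independent_of_unused V (pred1 i).
Proof.
move=> indep Ei J A C uJ AJ mC.
pose A' j := if j == i then V @^-1` C else A j.
have iJ : i \notin J by apply/negP => /AJ[]; rewrite /= eqxx.
have A'J j : j \in J -> A' j = A j.
  by rewrite /A'; case: eqP => // -> /(negP iJ).
have := indep (i :: J) A'; rewrite /= iJ uJ !bigcap_seq !big_cons.
rewrite [A' i]/A' eqxx.
rewrite (eq_big_seq _ A'J) (eq_big_seq _ (fun j jJ => congr1 P (A'J j jJ))).
apply=> // j; rewrite inE => /predU1P[->|jJ].
  by rewrite Ei /A' eqxx; exists C => //; rewrite setTI.
by rewrite A'J//; have [] := AJ _ jJ.
Qed.

Lemma independent_of_unused_comp (d1 d2 : measure_display)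
    (F1 : measurableType d1) (F2 : measurableType d2)
    (V : Omega -> F1) (s : F1 -> F2) (used : pred I) :
  measurable_fun setT s -> independent_of_unused V used ->
  independent_of_unused (s \o V) used.
Proof.
move=> ms iV J A C uJ AJ mC; rewrite comp_preimage; apply: iV => //.
by rewrite -[X in measurable X]setTI; exact: ms.
Qed.

Lemma independent_of_unused_sub (d1 : measure_display)
    (F1 : measurableType d1) (V : Omega -> F1) (used used' : pred I) :
  subpred used used' -> independent_of_unused V used ->
  independent_of_unused V used'.
Proof.
move=> uu' iV J A C uJ AJ mC; apply: iV => // i /AJ[nu' EA]; split=> //.
by apply: contra nu' => /uu'.
Qed.

Lemma independent_of_unused_one (d1 d2 : measure_display)
    (F : measurableType d1) (F' : measurableType d2)
    (V : Omega -> F) (N : Omega -> F') (used : pred I) (i : I) :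
  E i = preimage_set_system setT N measurable -> ~~ used i ->
  independent_of_unused V used ->
  forall C D, measurable C -> measurable D ->
  P (V @^-1` C `&` N @^-1` D) = P (V @^-1` C) * P (N @^-1` D).
Proof.
move=> Ei ui iV C D mC mD.
have := iV [:: i] (fun=> N @^-1` D) C; rewrite bigcap_seq !big_seq1; apply=> //.
move=> j; rewrite inE => /eqP ->; split=> //.
by rewrite Ei; exists D => //; rewrite setTI.
Qed.

(** For fixed events of the noises still unused, with intersection [B], the two
    measures [C |-> P ((V, N) \in C, B)] and [C |-> P ((V, N) \in C) P B] agree
    on rectangles, where the event of [N] counts as one more member of the
    family. *)
Lemma independent_of_unused_adjoin (d1 d2 : measure_display)
    (F : measurableType d1) (F' : measurableType d2)
    (V : Omega -> F) (N : Omega -> F') (used : pred I) (i : I) :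
  measurable_fun setT V -> measurable_fun setT N ->
  E i = preimage_set_system setT N measurable -> ~~ used i ->
  independent_of_unused V used ->
  independent_of_unused (fun o => (V o, N o)) (predU used (pred1 i)).
Proof.
move=> mV mN Ei ui iV J A C uJ AJ mC.
have iJ : i \notin J by apply/negP => /AJ[]; rewrite /= eqxx orbT.
have EA j : j \in J -> E j (A j) by case/AJ.
have uA j : j \in J -> ~~ used j by case/AJ; rewrite negb_or => /andP[].
set B := \bigcap_(j in [set` J]) A j.
have mB : measurable B by apply: fin_bigcap_measurable => [|j /EA/mE].
have mVN : measurable_fun setT (fun o => (V o, N o)).
  exact: measurable_fun_pair.
have PB : P B = \prod_(j <- J) P (A j).
  have := iV J A setT uJ; rewrite preimage_setT setTI probability_setT mul1e.
  by apply=> // j jJ; split; [exact: uA|exact: EA].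
have rect C1 D : measurable C1 -> measurable D ->
    P (V @^-1` C1 `&` N @^-1` D `&` B) = P (V @^-1` C1 `&` N @^-1` D) * P B.
  move=> mC1 mD; pose A' j := if j == i then N @^-1` D else A j.
  have EA'i : E i (A' i) by rewrite Ei /A' eqxx; exists D => //; rewrite setTI.
  have A'J j : j \in J -> A' j = A j.
    by rewrite /A'; case: eqP => // -> /(negP iJ).
  rewrite (independent_of_unused_one Ei ui iV)//.
  have := iV (i :: J) A' C1; rewrite /= iJ uJ bigcap_seq !big_cons.
  rewrite [A' i]/A' eqxx (eq_big_seq _ A'J).
  rewrite (eq_big_seq _ (fun j jJ => congr1 P (A'J j jJ))).
  rewrite -PB -bigcap_seq -/B setIA muleA.
  apply=> // j; rewrite inE => /predU1P[->//|jJ].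
  by rewrite A'J//; split; [exact: uA|exact: EA].
have PB_ge0 : (0 <= fine (P B))%R by rewrite fine_ge0.
have PBE : P B = (fine (P B))%:E by rewrite fineK// fin_num_measure.
rewrite -PB muleC.
pose m1 := pushforward (mrestr P mB) (fun o => (V o, N o)).
pose m2 := mscale (NngNum PB_ge0) (pushforward P (fun o => (V o, N o))).
rewrite [LHS](_ : _ = m1 C)// PBE [RHS](_ : _ = m2 mVN C)//.
apply: (@measure_eq_rectangles R _ _ F F' m1 (m2 mVN)) => //.
- rewrite /= /pushforward /mrestr/= preimage_setT setTI.
  exact: le_lt_trans (probability_le1 _ mB) (ltry _).
- move=> C1 D mC1 mD; have := rect _ _ mC1 mD.
  rewrite /m1 /m2 /= /pushforward /mrestr/= /mscale/= -PBE muleC.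
  exact.
Qed.

End relative.
End independence.

(** * Integrals against joint laws and densities *)

Section random_elements.
Context (R : realType) (d : measure_display) (Omega : measurableType d).
Context (P : probability Omega R).

(** Independence makes the law of [(V, N)] the image of [P \x P] under
    [(o, o') |-> (V o, N o')]; then Tonelli's theorem separates the two
    integrals. *)
Lemma integral_independent (d1 d2 : measure_display)
    (F1 : measurableType d1) (F2 : measurableType d2)
    (V : Omega -> F1) (N : Omega -> F2) (phi : F1 * F2 -> \bar R) :
  measurable_fun setT V -> measurable_fun setT N ->
  (forall C D, measurable C -> measurable D ->
    P (V @^-1` C `&` N @^-1` D) = P (V @^-1` C) * P (N @^-1` D)) ->
  measurable_fun [set: F1 * F2] phi -> (forall a, 0 <= phi a) ->
  \int[P]_o phi (V o, N o) = \int[P]_o \int[P]_o' phi (V o, N o').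
Proof.
move=> mV mN indep mphi phi0.
have mVN : measurable_fun setT (fun o => (V o, N o)).
  exact: measurable_fun_pair.
pose VN2 (a : Omega * Omega) := (V a.1, N a.2).
have mVN2 : measurable_fun setT VN2.
  by apply: measurable_fun_pair; apply: measurableT_comp.
pose m1 := pushforward P (fun o => (V o, N o)).
pose m2 := pushforward (P \x P) VN2.
have m12 A : measurable A -> m1 A = m2 A.
  apply: (@measure_eq_rectangles R _ _ F1 F2 m1 m2) => //.
    by rewrite /= /pushforward preimage_setT probability_setT ltry.
  move=> C D mC mD; rewrite /m1 /m2 /= /pushforward.
  rewrite [RHS](_ : _ = (P \x P) ((V @^-1` C) `*` (N @^-1` D)))//.
  rewrite product_measure1E; first exact: indep.
  - by rewrite -[X in measurable X]setTI; exact: mV.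
  - by rewrite -[X in measurable X]setTI; exact: mN.
have := @ge0_integral_pushforward _ _ _ _ R _ mVN P setT phi measurableT mphi.
rewrite preimage_setT => <-//; rewrite (eq_measure_integral m2); last first.
  by move=> A mA _; exact: m12.
rewrite ge0_integral_pushforward//= preimage_setT fubini_tonelli1//.
exact: measurableT_comp.
Qed.

(** The law of [S] is absolutely continuous with respect to [mu], and [p] agrees
    almost everywhere with its Radon-Nikodym derivative, because both have the
    same integrals over measurable sets. *)
Lemma integral_density (d1 : measure_display) (E : measurableType d1)
    (mu : {sigma_finite_measure set E -> \bar R}) (S : Omega -> E) (p : E -> R)
    (phi : E -> \bar R) :
  measurable_fun setT S -> is_density mu p ->
  (forall A, measurable A -> P (S @^-1` A) = \int[mu]_(x in A) (p x)%:E) ->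
  measurable_fun setT phi -> (forall x, 0 <= phi x) ->
  \int[P]_o phi (S o) = \int[mu]_x (phi x * (p x)%:E).
Proof.
move=> mS [mp p0 p1] SE mphi phi0.
pose S_mixin := isMeasurableFun.Build _ _ _ _ _ mS.
pose SP : {mfun Omega >-> E} := HB.pack S S_mixin.
pose nu := distribution P SP.
have nuE A : measurable A -> nu A = \int[mu]_(x in A) (p x)%:E.
  exact: SE.
have numu : nu `<< mu.
  apply/null_content_dominatesP => A mA muA.
  rewrite nuE//; apply: null_set_integral => //.
  by apply: measurable_funTS; exact/measurable_EFinP.
have pE : ae_eq mu setT (Radon_Nikodym_SigmaFinite.f nu mu) (EFin \o p).
  apply: integral_ae_eq => //.
  - exact: Radon_Nikodym_SigmaFinite.f_integrable.
  - exact/measurable_EFinP.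
  - move=> A _ mA; rewrite -Radon_Nikodym_SigmaFinite.f_integral//.
    exact: nuE.
transitivity (\int[nu]_x phi x).
  by rewrite ge0_integral_pushforward.
rewrite -(Radon_Nikodym_SigmaFinite.change_of_variables numu)//.
apply: ae_eq_integral => //.
- apply: emeasurable_funM => //.
  exact/(measurable_int _ (Radon_Nikodym_SigmaFinite.f_integrable numu)).
- by apply: emeasurable_funM => //; exact/measurable_EFinP.
- by apply: filterS pE => x /= /(_ I) -> _.
Qed.
End random_elements.

(** * Prediction and Bayes' rule for densities *)

(** Re-indexing maps between nested products are tuples of iterated
    projections; this proves their measurability, leaving other components. *)
Ltac measurable_projections :=
  repeat first [ exact: measurable_id | exact: measurable_cst
               | exact: measurable_fst | exact: measurable_snd
               | apply: measurable_fun_pair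
               | apply: (measurableT_comp measurable_fst)
               | apply: (measurableT_comp measurable_snd) ].

Section conditional_densities.
Context (R : realType).

Lemma measurable_uncurried (dF dE dG dT : measure_display)
    (F : measurableType dF) (E : measurableType dE) (G : measurableType dG)
    (T : measurableType dT) (q : F -> E -> T) (s : G -> F) (t : G -> E) :
  measurable_fun [set: F * E] (fun a : F * E => q a.1 a.2) ->
  measurable_fun setT s -> measurable_fun setT t ->
  measurable_fun setT (fun a => q (s a) (t a)).
Proof.
by move=> mq ms mt; exact: (measurableT_comp mq (measurable_fun_pair ms mt)).
Qed.

Lemma density_kernel_comp (dF dG dE : measure_display) (F : measurableType dF)
    (G : measurableType dG) (E : measurableType dE)
    (mu : {sigma_finite_measure set E -> \bar R}) (q : F -> E -> R)
    (s : G -> F) :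
  measurable_fun setT s -> density_kernel mu q ->
  density_kernel mu (fun k => q (s k)).
Proof.
move=> ms [mq dq]; split=> [|k]; last exact: dq.
by apply: (measurable_uncurried mq); [exact: measurableT_comp|].
Qed.

(** The denominator is nonnegative, and on nonnegative reals inversion is the
    real power -1, a measurable function. *)
Lemma measurable_normalized (dG : measure_display) (G : measurableType dG)
    (m : G -> \bar R) (v w : G -> R) :
  measurable_fun setT m -> (forall a, 0 <= m a) ->
  measurable_fun setT v -> measurable_fun setT w ->
  measurable_fun setT
    (fun a => if 0 < m a < +oo then (v a / fine (m a))%R else w a).
Proof.
move=> mm m0 mv mw; apply: measurable_fun_ifT => //.
  by apply: measurable_and; apply: measurable_fun_lte.
apply: measurable_funM => //.
under eq_fun do rewrite -powR_inv1 ?fine_ge0//.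
apply: (measurableT_comp (measurable_powR _)).
exact: measurableT_comp.
Qed.

Section density_transformations.
Context (dE dY : measure_display) (E : measurableType dE).
Context (Y : measurableType dY).
Context (mu : {sigma_finite_measure set E -> \bar R}).
Context (nu : {sigma_finite_measure set Y -> \bar R}).

(** The second marginal of the joint density [r x y * p x]: the predicted
    density when [r] is a transition density, the normalizing factor of Bayes'
    rule when [r] is a likelihood. It can be infinite on a null set. *)
Definition mixture (r : E -> Y -> R) (p : E -> R) (y : Y) : \bar R :=
  \int[mu]_x (r x y * p x)%:E.

Definition predict (r : E -> Y -> R) (p : E -> R) (y : Y) : R :=
  fine (mixture r p y).

(** The prior is a default value where the normalizing factor is not usable; it
    keeps [bayes r p y] a density for every [y]. *)
Definition bayes (r : E -> Y -> R) (p : E -> R) (y : Y) (x : E) : R :=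
  if 0 < mixture r p y < +oo
  then (r x y * p x / fine (mixture r p y))%R else p x.

Section fixed_densities.
Context (r : E -> Y -> R) (p : E -> R).
Hypotheses (dr : density_kernel nu r) (dp : is_density mu p).

Let r0 x y : (0 <= r x y)%R. Proof. by have [_ /(_ x) []] := dr. Qed.
Let p0 x : (0 <= p x)%R. Proof. by have [] := dp. Qed.
Let mp : measurable_fun setT p. Proof. by have [] := dp. Qed.
Let mr : measurable_fun [set: E * Y] (fun a : E * Y => r a.1 a.2).
Proof. by have [] := dr. Qed.

Let mrp : measurable_fun [set: E * Y]
  (fun a : E * Y => (r a.1 a.2 * p a.1)%:E).
Proof.
by apply/measurable_EFinP/measurable_funM => //; exact: measurableT_comp.
Qed.

Lemma mixture_ge0 y : 0 <= mixture r p y.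
Proof. by apply: integral_ge0 => x _; rewrite lee_fin mulr_ge0. Qed.

Lemma measurable_mixture : measurable_fun setT (mixture r p).
Proof.
apply: (@measurable_fun_fubini_tonelli_G _ _ E Y R mu _ mrp) => a.
by rewrite lee_fin mulr_ge0.
Qed.

Lemma integral_joint_density (psi : E * Y -> \bar R) :
  measurable_fun setT psi -> (forall a, 0 <= psi a) ->
  \int[mu]_x ((\int[nu]_y (psi (x, y) * (r x y)%:E)) * (p x)%:E) =
  \int[nu]_y \int[mu]_x (psi (x, y) * (r x y * p x)%:E).
Proof.
move=> mpsi psi0.
have mpsix x : measurable_fun setT (fun y => psi (x, y)).
  exact: measurable_fun_pair2.
have mrx x : measurable_fun setT (r x).
  by have [_ /(_ x) []] := dr.
transitivity (\int[mu]_x \int[nu]_y (psi (x, y) * (r x y * p x)%:E)).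
  apply: eq_integral => x _; rewrite -ge0_integralZr//.
  - by under eq_integral do rewrite -muleA -EFinM.
  - by apply: emeasurable_funM => //; exact/measurable_EFinP.
  - by move=> y _; rewrite mule_ge0 ?lee_fin.
  - by rewrite lee_fin.
apply: (@fubini_tonelli _ _ E Y R mu nu
  (fun a => psi a * (r a.1 a.2 * p a.1)%:E)) => //.
- exact: emeasurable_funM.
- by move=> a; rewrite mule_ge0 ?lee_fin ?mulr_ge0.
Qed.

Lemma integral_mixture (psi : Y -> \bar R) :
  measurable_fun setT psi -> (forall y, 0 <= psi y) ->
  \int[nu]_y (psi y * mixture r p y) =
  \int[mu]_x ((\int[nu]_y (psi y * (r x y)%:E)) * (p x)%:E).
Proof.
move=> mpsi psi0.
rewrite (@integral_joint_density (fun a => psi a.2))//; last first.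
  exact: measurableT_comp.
apply: eq_integral => y _; rewrite /= ge0_integralZl//.
- exact: (measurable_fun_pair1 y mrp).
- by move=> x _; rewrite lee_fin mulr_ge0.
Qed.

Lemma integral_mixture1 : \int[nu]_y mixture r p y = 1.
Proof.
have := integral_mixture (measurable_cst 1) (fun=> lee01).
under eq_integral do rewrite /cst mul1e.
move=> ->; transitivity (\int[mu]_x (p x)%:E); last by have [] := dp.
apply: eq_integral => x _; under eq_integral do rewrite /cst mul1e.
by have [_ /(_ x)[_ _ ->]] := dr; rewrite mul1e.
Qed.

Lemma ae_mixture_fin_num : {ae nu, forall y, mixture r p y \is a fin_num}.
Proof.
have : nu.-integrable setT (mixture r p).
  apply/integrableP; split; first exact: measurable_mixture.
  under eq_integral do rewrite gee0_abs ?mixture_ge0//.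
  by rewrite integral_mixture1 ltry.
move/(integrable_ae measurableT).
by apply: filterS => y /(_ I).
Qed.

Lemma integral_predict (psi : Y -> \bar R) :
  measurable_fun setT psi -> (forall y, 0 <= psi y) ->
  \int[nu]_y (psi y * (predict r p y)%:E) =
  \int[mu]_x ((\int[nu]_y (psi y * (r x y)%:E)) * (p x)%:E).
Proof.
move=> mpsi psi0; rewrite -integral_mixture//.
apply: ae_eq_integral => //.
- apply: emeasurable_funM => //; apply/measurable_EFinP.
  by apply: measurableT_comp => //; exact: measurable_mixture.
- by apply: emeasurable_funM => //; exact: measurable_mixture.
- by apply: filterS ae_mixture_fin_num => y fin_y _; rewrite /predict fineK.
Qed.

Lemma is_density_predict : is_density nu (predict r p).
Proof.
split.
- by apply: measurableT_comp => //; exact: measurable_mixture.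
- by move=> y; rewrite fine_ge0// mixture_ge0.
- have := integral_predict (measurable_cst 1) (fun=> lee01).
  under eq_integral do rewrite /cst mul1e.
  move=> ->; rewrite -integral_mixture ?integral_mixture1//.
  by under eq_integral do rewrite /cst mul1e; rewrite integral_mixture1.
Qed.

Lemma is_density_bayes y : is_density mu (bayes r p y).
Proof.
rewrite /bayes.
case: (boolP (0 < mixture r p y < +oo)) => [/andP[m0 moo]|_]; last by [].
have mfin : mixture r p y \is a fin_num by rewrite ge0_fin_numE ?ltW.
have m0' : (0 < fine (mixture r p y))%R by rewrite fine_gt0// m0.
have mry : measurable_fun setT (r ^~ y).
  by apply: (measurable_uncurried mr); measurable_projections.
split.
- by do 2 (apply: measurable_funM => //).
- by move=> x; rewrite divr_ge0 ?mulr_ge0// ltW.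
- under eq_integral do rewrite EFinM.
  rewrite ge0_integralZr//.
  + by rewrite -[X in X * _]fineK// -EFinM divff// gt_eqF.
  + exact/measurable_EFinP/measurable_funM.
  + by move=> x _; rewrite lee_fin mulr_ge0.
  + by rewrite lee_fin invr_ge0 ltW.
Qed.

(** Both sides integrate [psi] against the joint density [r x y * p x]. For
    fixed [y] the inner integrals agree when the normalizing factor is positive
    and finite, by definition of [bayes], and both contributions are zero when it
    is zero. It is finite for almost every [y]. *)
Lemma integral_bayes (psi : E * Y -> \bar R) :
  measurable_fun setT psi -> (forall a, 0 <= psi a) ->
  \int[mu]_x ((\int[nu]_y (psi (x, y) * (r x y)%:E)) * (p x)%:E) =
  \int[nu]_y (mixture r p y * \int[mu]_x (psi (x, y) * (bayes r p y x)%:E)).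
Proof.
move=> mpsi psi0; rewrite integral_joint_density//.
have mb : measurable_fun [set: E * Y] (fun a => bayes r p a.2 a.1).
  apply: measurable_normalized.
  - by apply: measurableT_comp => //; exact: measurable_mixture.
  - by move=> a; exact: mixture_ge0.
  - exact/measurable_EFinP.
  - exact: measurableT_comp.
have b0 y x : (0 <= bayes r p y x)%R by have [] := is_density_bayes y.
have mpsiy y : measurable_fun setT (fun x => psi (x, y)).
  exact: measurable_fun_pair1.
have mrpy y : measurable_fun setT (fun x => (r x y * p x)%:E).
  exact: (measurable_fun_pair1 y mrp).
have mby y : measurable_fun setT (bayes r p y).
  by have [] := is_density_bayes y.
apply: ae_eq_integral => //.
- apply: (@measurable_fun_fubini_tonelli_G _ _ E Y R mu
    (fun a => psi a * (r a.1 a.2 * p a.1)%:E)).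
    exact: emeasurable_funM.
  by move=> a; rewrite mule_ge0 ?lee_fin ?mulr_ge0.
- apply: emeasurable_funM; first exact: measurable_mixture.
  apply: (@measurable_fun_fubini_tonelli_G _ _ E Y R mu
    (fun a => psi a * (bayes r p a.2 a.1)%:E)).
    by apply: emeasurable_funM => //; exact/measurable_EFinP.
  by move=> a; rewrite mule_ge0 ?lee_fin.
apply: filterS ae_mixture_fin_num => y mfin _.
have [m0|m0] := eqVneq (mixture r p y) 0.
  rewrite m0 mul0e.
  have rp0 : ae_eq mu setT (fun x => (r x y * p x)%:E) (cst 0).
    apply/ae_eq_integral_abs => //; rewrite -[RHS]m0.
    by apply: eq_integral => x _; rewrite gee0_abs// lee_fin mulr_ge0.
  rewrite -[RHS](integral0 mu setT); apply: ae_eq_integral => //.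
    exact: emeasurable_funM.
  by apply: filterS rp0 => x /(_ I) /= -> _; rewrite mule0.
have mgt0 : 0 < mixture r p y by rewrite lt0e m0 mixture_ge0.
have moo : mixture r p y < +oo by rewrite ltey_eq mfin.
rewrite -ge0_integralZl//.
- apply: eq_integral => x _.
  rewrite /bayes mgt0 moo/= muleCA -[X in psi _ * (X * _)]fineK// -EFinM.
  by rewrite mulrCA divff ?mulr1// gt_eqF// fine_gt0// mgt0.
- by apply: emeasurable_funM => //; exact/measurable_EFinP.
- by move=> x _; rewrite mule_ge0 ?lee_fin.
- exact: mixture_ge0.
Qed.

End fixed_densities.
Section kernels.
Context (dF : measure_display) (F : measurableType dF).
Context (r : E * F -> Y -> R) (p : F -> E -> R).
Hypotheses (dr : density_kernel nu r) (dp : density_kernel mu p).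

Let drk k : density_kernel nu (fun x => r (x, k)).
Proof. by apply: density_kernel_comp dr; measurable_projections. Qed.

Let mix0 k y : 0 <= mixture (fun x => r (x, k)) (p k) y.
Proof. by apply: mixture_ge0; [exact: drk|have [_] := dp; exact]. Qed.

Lemma measurable_mixture_kernel : measurable_fun [set: F * Y]
  (fun a => mixture (fun x => r (x, a.1)) (p a.1) a.2).
Proof.
have [mr dr'] := dr; have [mp dp'] := dp.
apply: (@measurable_fun_fubini_tonelli_G _ _ E (F * Y)%type R mu
  (fun a => (r (a.1, a.2.1) a.2.2 * p a.2.1 a.1)%:E)) => [|a].
  apply/measurable_EFinP/measurable_funM.
    by apply: (measurable_uncurried mr); measurable_projections.
  by apply: (measurable_uncurried mp); measurable_projections.
have [_ r0 _] := dr' (a.1, a.2.1); have [_ p0 _] := dp' a.2.1.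
by rewrite lee_fin mulr_ge0.
Qed.

Lemma density_kernel_predict :
  density_kernel nu (fun k => predict (fun x => r (x, k)) (p k)).
Proof.
split=> [|k].
  by apply: measurableT_comp => //; exact: measurable_mixture_kernel.
by apply: is_density_predict; [exact: drk|have [_] := dp; exact].
Qed.

Lemma density_kernel_bayes :
  density_kernel mu
    (fun k : F * Y => bayes (fun x => r (x, k.1)) (p k.1) k.2).
Proof.
have [mr _] := dr; have [mp _] := dp.
have mpE : measurable_fun [set: F * Y * E] (fun a => p a.1.1 a.2).
  by apply: (measurable_uncurried mp); measurable_projections.
split=> [|k]; last first.
  by apply: is_density_bayes; [exact: drk|have [_] := dp; exact].
apply: measurable_normalized => //.
  exact: (measurableT_comp measurable_mixture_kernel).
apply: measurable_funM => //.
by apply: (measurable_uncurried mr); measurable_projections.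
Qed.

End kernels.

End density_transformations.
End conditional_densities.

(** * Conditional densities as disintegrations *)

Section conditional_laws.
Context (R : realType) (d : measure_display) (Omega : measurableType d).
Context (P : probability Omega R).

(** The conditional density of [S] given [H], tested on all nonnegative
    functions of the pair instead of rectangles: such functions are what remains
    after integrating out one of several variables, so this form can be
    iterated. *)
Definition disintegrates (dE dF : measure_display) (E : measurableType dE)
    (F : measurableType dF) (mu : {sigma_finite_measure set E -> \bar R})
    (S : Omega -> E) (H : Omega -> F) (q : F -> E -> R) : Prop :=
  forall phi : E * F -> \bar R, measurable_fun setT phi ->
    (forall a, 0 <= phi a) ->
    \int[P]_o phi (S o, H o) =
    \int[P]_o \int[mu]_x (phi (x, H o) * (q (H o) x)%:E).

Section two_variables.
Context (dE dF : measure_display) (E : measurableType dE).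
Context (F : measurableType dF) (mu : {sigma_finite_measure set E -> \bar R}).
Context (S : Omega -> E) (H : Omega -> F).

Lemma is_conditional_density_disintegrates (q : F -> E -> R) :
  measurable_fun setT H -> measurable_fun setT S ->
  density_kernel mu q -> disintegrates mu S H q ->
  is_conditional_density P mu S H q.
Proof.
move=> mH mS dq SHq; split=> // A B mA mB.
have mHB : measurable (H @^-1` B).
  by rewrite -[X in measurable X]setTI; exact: mH.
have mSA : measurable (S @^-1` A).
  by rewrite -[X in measurable X]setTI; exact: mS.
pose phi (a : E * F) : \bar R := (\1_A a.1 * \1_B a.2)%:E.
have := SHq phi; rewrite /phi /= => SHq1.
transitivity (\int[P]_o phi (S o, H o)).
  rewrite -[X in P X]setIT -integral_indic//; last exact: measurableI.
  apply: eq_integral => o _; rewrite /phi /=.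
  by rewrite indicI.
rewrite SHq1; last 2 first.
- apply/measurable_EFinP/measurable_funM.
  + by apply: (measurableT_comp (measurable_indic mA)); exact: measurable_fst.
  + by apply: (measurableT_comp (measurable_indic mB)); exact: measurable_snd.
- by move=> a; rewrite lee_fin mulr_ge0.
rewrite [RHS]integral_mkcond; apply: eq_integral => o _.
rewrite patchE; case: ifPn => oB.
  rewrite [RHS]integral_mkcond; apply: eq_integral => x _.
  have HoB : H o \in B by move: oB; rewrite !inE.
  rewrite patchE indicE [\1_B (H o)]indicE HoB mulr1.
  by case: ifP => _; rewrite ?mul1e ?mul0e.
apply: integral0_eq => x _; rewrite [\1_B (H o)]indicE.
have /negbTE -> : H o \notin B.
  by apply: contra oB; rewrite !inE.
by rewrite mulr0 mul0e.
Qed.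

(** This is how the action enters: being a function of the history, it can be
    added to the conditioning variable without changing the density. *)
Lemma disintegrates_enlarge (dG : measure_display) (G : measurableType dG)
    (s : F -> G) (q : F -> E -> R) :
  measurable_fun setT s -> disintegrates mu S H q ->
  disintegrates mu S (fun o => (H o, s (H o))) (fun k => q k.1).
Proof.
move=> ms SHq phi mphi phi0.
rewrite (SHq (fun a => phi (a.1, (a.2, s a.2))))//.
apply: (measurableT_comp mphi); measurable_projections.
exact: measurableT_comp.
Qed.

Lemma disintegrates_factor (dG : measure_display) (G : measurableType dG)
    (s : F -> G) (q : G -> E -> R) :
  measurable_fun setT s -> disintegrates mu S H (fun k => q (s k)) ->
  disintegrates mu S (s \o H) q.
Proof.
move=> ms SHq phi mphi phi0.
rewrite (SHq (fun a => phi (a.1, s a.2)))//.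
apply: (measurableT_comp mphi); measurable_projections.
exact: measurableT_comp.
Qed.

(** Freezing [H o] turns [s (H o) (N _)] into a variable of density [q (H o)],
    because [N] is independent of [H]. *)
Lemma disintegrates_independent (dN : measure_display) (N' : measurableType dN)
    (N : Omega -> N') (s : F -> N' -> E) (q : F -> E -> R) :
  measurable_fun setT H -> measurable_fun setT N ->
  (forall C D, measurable C -> measurable D ->
    P (H @^-1` C `&` N @^-1` D) = P (H @^-1` C) * P (N @^-1` D)) ->
  measurable_fun [set: F * N'] (fun a : F * N' => s a.1 a.2) ->
  density_kernel mu q ->
  (forall k A, measurable A ->
    P ((fun o => s k (N o)) @^-1` A) = \int[mu]_(x in A) (q k x)%:E) ->
  disintegrates mu (fun o => s (H o) (N o)) H q.
Proof.
move=> mH mN indep ms [_ dq] qE phi mphi phi0.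
rewrite (@integral_independent _ _ _ P _ _ _ _ H N
  (fun a => phi (s a.1 a.2, a.1)))//; last first.
  by apply: (measurableT_comp mphi); measurable_projections.
apply: eq_integral => o _ /=.
apply: (@integral_density _ _ _ P _ E mu (fun o' => s (H o) (N o')) _
  (fun x => phi (x, H o))) => //.
- by apply: (measurable_uncurried ms).
- exact: qE.
- exact: measurable_fun_pair1.
Qed.

End two_variables.

Section three_variables.
Context (dE dF dY : measure_display) (E : measurableType dE).
Context (F : measurableType dF) (Y : measurableType dY).
Context (mu : {sigma_finite_measure set E -> \bar R}).
Context (nu : {sigma_finite_measure set Y -> \bar R}).
Context (S : Omega -> E) (H : Omega -> F) (V : Omega -> Y).
Context (r : E * F -> Y -> R) (p : F -> E -> R).
Hypotheses (dr : density_kernel nu r) (dp : density_kernel mu p).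
Hypotheses (SH : disintegrates mu S H p).
Hypotheses (VSH : disintegrates nu V (fun o => (S o, H o)) r).

(** The chain rule: the joint law of [(V, S)] given [H] has density [r * p]. *)
Lemma integral_three_variables (phi : Y * (E * F) -> \bar R) :
  measurable_fun setT phi -> (forall a, 0 <= phi a) ->
  \int[P]_o phi (V o, (S o, H o)) =
  \int[P]_o \int[mu]_x ((\int[nu]_y
     (phi (y, (x, H o)) * (r (x, H o) y)%:E)) * (p (H o) x)%:E).
Proof.
move=> mphi phi0; rewrite (VSH mphi phi0).
apply: (SH (phi := fun a => \int[nu]_y (phi (y, a) * (r a y)%:E))) => [|a].
  apply: (@measurable_fun_fubini_tonelli_G _ _ Y (E * F)%type R nu
    (fun a => phi a * (r a.2 a.1)%:E)) => [|a].
    apply: emeasurable_funM => //; apply/measurable_EFinP.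
    by apply: (measurable_uncurried (proj1 dr)); measurable_projections.
  by have [_ /(_ a.2)[_ r0 _]] := dr; rewrite mule_ge0 ?lee_fin.
apply: integral_ge0 => y _; have [_ /(_ a)[_ r0 _]] := dr.
by rewrite mule_ge0 ?lee_fin.
Qed.

Let drk k : density_kernel nu (fun x => r (x, k)).
Proof. by apply: density_kernel_comp dr; measurable_projections. Qed.

Let dpk k : is_density mu (p k). Proof. by have [_] := dp; exact. Qed.

Lemma disintegrates_predict :
  disintegrates nu V H (fun k => predict mu (fun x => r (x, k)) (p k)).
Proof.
move=> phi mphi phi0.
rewrite (@integral_three_variables (fun a => phi (a.1, a.2.2)))//; last first.
  by apply: (measurableT_comp mphi); measurable_projections.
apply: eq_integral => o _; rewrite (integral_predict (drk _) (dpk _))//.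
exact: measurable_fun_pair1.
Qed.

(** With [Phi k] the integral of [phi (_, k)] against the posterior at [k], both
    sides equal the expectation of the integral over [y] of
    [mixture y * Phi (H, y)]. The left side does by [integral_bayes] applied to
    [phi], and the right side by the same lemma applied to [Phi], since the
    posterior has total mass one. *)
Lemma disintegrates_bayes :
  disintegrates mu S (fun o => (H o, V o))
    (fun k => bayes mu (fun x => r (x, k.1)) (p k.1) k.2).
Proof.
move=> phi mphi phi0.
pose post (k : F * Y) := bayes mu (fun x => r (x, k.1)) (p k.1) k.2.
have [mpost dpost] : density_kernel mu post.
  exact: (density_kernel_bayes dr dp).
have post0 k x : (0 <= post k x)%R by have [] := dpost k.
pose Phi k := \int[mu]_x (phi (x, k) * (post k x)%:E).
have mPhi : measurable_fun setT Phi.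
  apply: (@measurable_fun_fubini_tonelli_G _ _ E (F * Y)%type R mu
    (fun a => phi a * (post a.2 a.1)%:E)) => [|a].
    apply: emeasurable_funM => //; apply/measurable_EFinP.
    by apply: (measurable_uncurried mpost); measurable_projections.
  by rewrite mule_ge0 ?lee_fin.
have Phi0 k : 0 <= Phi k.
  by apply: integral_ge0 => x _; rewrite mule_ge0 ?lee_fin.
have mphi' : measurable_fun [set: Y * (E * F)]
    (fun a => phi (a.2.1, (a.2.2, a.1))).
  by apply: (measurableT_comp mphi); measurable_projections.
have mPhi' : measurable_fun [set: Y * (E * F)] (fun a => Phi (a.2.2, a.1)).
  by apply: (measurableT_comp mPhi); measurable_projections.
apply: (etrans (integral_three_variables mphi' (fun=> phi0 _))).
apply: (etrans _ (esym (integral_three_variables mPhi' (fun=> Phi0 _)))).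
apply: eq_integral => o _ /=.
have mphio : measurable_fun [set: E * Y] (fun a => phi (a.1, (H o, a.2))).
  by apply: (measurableT_comp mphi); measurable_projections.
have mPhio : measurable_fun [set: E * Y] (fun a => Phi (H o, a.2)).
  by apply: (measurableT_comp mPhi); measurable_projections.
apply: (etrans (integral_bayes (drk _) (dpk _) mphio (fun=> phi0 _))).
apply: (etrans _ (esym (integral_bayes (drk _) (dpk _) mPhio (fun=> Phi0 _)))).
apply: eq_integral => y _ /=; congr (_ * _).
have [mpk _ pk1] := dpost (H o, y).
rewrite ge0_integralZl//.
- by rewrite pk1 mule1.
- exact/measurable_EFinP.
- by move=> x _; rewrite lee_fin; exact: (post0 (H o, y)).
Qed.

End three_variables.
End conditional_laws.

(** * The filter *)

Section one_step.
Context (R : realType) (d : measure_display) (Omega : measurableType d).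
Context (P : probability Omega R).

(** One step of the system seen abstractly: [H] is the history together with the
    action, [V1] the disturbance, [V2] the sensor noise. *)
Lemma disintegrates_one_step
    (dE dF dE' dY dN1 dN2 : measure_display) (E : measurableType dE)
    (F : measurableType dF) (E' : measurableType dE') (Y : measurableType dY)
    (N1 : measurableType dN1) (N2 : measurableType dN2)
    (mu : {sigma_finite_measure set E -> \bar R})
    (mu' : {sigma_finite_measure set E' -> \bar R})
    (nu : {sigma_finite_measure set Y -> \bar R})
    (S : Omega -> E) (H : Omega -> F) (V1 : Omega -> N1) (V2 : Omega -> N2)
    (s : E * F -> N1 -> E') (h : E' -> N2 -> Y)
    (p : F -> E -> R) (q : E * F -> E' -> R) (r : E' -> Y -> R) :
  let S' o := s (S o, H o) (V1 o) in
  measurable_fun setT S -> measurable_fun setT H ->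
  measurable_fun setT V1 -> measurable_fun setT V2 ->
  measurable_fun [set: (E * F) * N1] (fun a => s a.1 a.2) ->
  measurable_fun [set: E' * N2] (fun a => h a.1 a.2) ->
  (forall C D, measurable C -> measurable D ->
    P ((fun o => (S o, H o)) @^-1` C `&` V1 @^-1` D) =
    P ((fun o => (S o, H o)) @^-1` C) * P (V1 @^-1` D)) ->
  (forall C D, measurable C -> measurable D ->
    P ((fun o => (S' o, H o)) @^-1` C `&` V2 @^-1` D) =
    P ((fun o => (S' o, H o)) @^-1` C) * P (V2 @^-1` D)) ->
  density_kernel mu p -> density_kernel mu' q -> density_kernel nu r ->
  (forall a A, measurable A ->
    P ((fun o => s a (V1 o)) @^-1` A) = \int[mu']_(x in A) (q a x)%:E) ->
  (forall x A, measurable A ->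
    P ((fun o => h x (V2 o)) @^-1` A) = \int[nu]_(y in A) (r x y)%:E) ->
  disintegrates P mu S H p ->
  disintegrates P mu' S' (fun o => (H o, h (S' o) (V2 o)))
    (fun k => bayes mu' r (predict mu (fun x => q (x, k.1)) (p k.1)) k.2).
Proof.
move=> S' mS mH mV1 mV2 ms mh indep1 indep2 dp dq dr qE rE SH.
have mSH : measurable_fun setT (fun o => (S o, H o)).
  exact: measurable_fun_pair.
have mS' : measurable_fun setT S' by exact: (measurable_uncurried ms).
have mS'H : measurable_fun setT (fun o => (S' o, H o)).
  exact: measurable_fun_pair.
have drk : density_kernel nu (fun a : E' * F => r a.1).
  exact: density_kernel_comp.
have S'SH : disintegrates P mu' S' (fun o => (S o, H o)) q.
  exact: disintegrates_independent.
have S'H := disintegrates_predict dq dp SH S'SH.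
have YS'H : disintegrates P nu (fun o => h (S' o) (V2 o))
    (fun o => (S' o, H o)) (fun a => r a.1).
  apply: (disintegrates_independent (H := fun o => (S' o, H o)) (N := V2)
    (s := fun a => h a.1)) => //.
    by apply: (measurable_uncurried mh); measurable_projections.
  by move=> a; exact: rE.
exact: (disintegrates_bayes drk (density_kernel_predict dq dp) S'H YS'H).
Qed.

End one_step.

Section nonlinear_filter.
Context (R : realType) (T : nat).
Context (dX : nat -> measure_display) (X : forall t, measurableType (dX t)).
Context (dU : nat -> measure_display) (U : forall t, measurableType (dU t)).
Context (dY : measure_display) (Y : measurableType dY).
Context (mu : forall t, {sigma_finite_measure set (X t * X t)%type -> \bar R}).
Context (nu : nat -> {sigma_finite_measure set Y -> \bar R}).
Context (p0 : X 0%N * X 0%N -> R).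
Context (q : forall t, X t * X t * U t -> X t.+1 * X t.+1 -> R).
Context (r : forall t, X t -> Y -> R).

Definition filter_update t (p : X t * X t -> R) (y : Y) (u : U t) :
    X t.+1 * X t.+1 -> R :=
  bayes (mu t.+1) (fun x => r x.1) (predict (mu t) (fun x => q (x, u)) p) y.

Fixpoint information_state t : hist Y U t -> X t * X t -> R :=
  match t return hist Y U t -> X t * X t -> R with
  | 0%N => bayes (mu 0%N) (fun x => r x.1) p0
  | s.+1 => fun k => filter_update (information_state k.1.1) k.2 k.1.2
  end.

Hypothesis dp0 : is_density (mu 0%N) p0.
Hypothesis dq : forall t, (t < T)%N -> density_kernel (mu t.+1) (q (t := t)).
Hypothesis dr : forall t, (t <= T)%N -> density_kernel (nu t) (r (t := t)).

Let dr1 t : (t <= T)%N ->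
  density_kernel (nu t) (fun x : X t * X t => r x.1).
Proof. by move=> tT; apply: density_kernel_comp (dr tT). Qed.

Let dqu t u : (t < T)%N ->
  density_kernel (mu t.+1) (fun x : X t * X t => q (x, u)).
Proof.
by move=> tT; apply: density_kernel_comp (dq tT); measurable_projections.
Qed.

Lemma is_density_filter_update t p y u : (t < T)%N ->
  is_density (mu t) p -> is_density (mu t.+1) (filter_update p y u).
Proof.
move=> tT dp; apply: (is_density_bayes (dr1 tT)).
exact: (is_density_predict (dqu u tT)).
Qed.

(** The prior enters the update only under an integral, so changing it on a null
    set leaves the new density unchanged at every point. *)
Lemma filter_update_ae_eq t p p' y u : (t < T)%N ->
  is_density (mu t) p -> is_density (mu t) p' ->
  {ae mu t, forall x, p x = p' x} ->
  filter_update p y u = filter_update p' y u.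
Proof.
move=> tT dp dp' pp'; congr (bayes _ _ _ _); apply/funext => x'.
congr fine; have [mq _] := dqu u tT.
have mqx : measurable_fun setT (fun x => q (x, u) x').
  exact: (measurable_fun_pair1 x' mq).
have [mp _ _] := dp; have [mp' _ _] := dp'.
apply: ae_eq_integral => //.
- exact/measurable_EFinP/measurable_funM.
- exact/measurable_EFinP/measurable_funM.
- by apply: filterS pp' => x -> _.
Qed.

Lemma density_kernel_information_state t : (t <= T)%N ->
  density_kernel (mu t) (information_state (t := t)).
Proof.
elim: t => [_|t IH tT].
  have dp0k : density_kernel (mu 0%N) (fun _ : unit => p0).
    split=> // ; have [mp0 _ _] := dp0; exact: measurableT_comp.
  have dr0k : density_kernel (nu 0%N) (fun a : X 0 * X 0 * unit => r a.1.1).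
    by apply: density_kernel_comp (dr (leq0n T)); measurable_projections.
  have := density_kernel_bayes dr0k dp0k.
  apply: (density_kernel_comp (s := fun y => (tt, y))).
  by measurable_projections.
have dpk : density_kernel (mu t)
    (fun k : hist Y U t * U t => information_state k.1).
  by apply: density_kernel_comp (IH (ltnW tT)).
have dqk : density_kernel (mu t.+1)
    (fun a : X t * X t * (hist Y U t * U t) => q (a.1, a.2.2)).
  by apply: density_kernel_comp (dq tT); measurable_projections.
have drk : density_kernel (nu t.+1)
    (fun a : X t.+1 * X t.+1 * (hist Y U t * U t) => r a.1.1).
  by apply: density_kernel_comp (dr tT); measurable_projections.
exact: (density_kernel_bayes drk (density_kernel_predict dqk dpk)).
Qed.

Context (d : measure_display) (Omega : measurableType d).
Context (P : probability Omega R).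
Context (dW : measure_display) (WT : measurableType dW).
Context (dZ : measure_display) (ZT : measurableType dZ).
Context (X0 : {RV P >-> X 0%N}) (W : nat -> {RV P >-> WT}).
Context (Z : nat -> {RV P >-> ZT}).
Hypothesis indep : mutually_independent P (primitive_sigma T X0 W Z).
Context (f fhat : forall t, X t -> U t -> WT -> X t.+1).
Context (h : forall t, X t -> ZT -> Y).
Hypothesis mf : forall t, (t < T)%N ->
  measurable_fun [set: X t * U t * WT]
    (fun a : X t * U t * WT => f a.1.1 a.1.2 a.2).
Hypothesis mfhat : forall t, (t < T)%N ->
  measurable_fun [set: X t * U t * WT]
    (fun a : X t * U t * WT => fhat a.1.1 a.1.2 a.2).
Hypothesis mh : forall t, (t <= T)%N ->
  measurable_fun [set: X t * ZT] (fun a : X t * ZT => h a.1 a.2).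
Hypothesis p0E : forall A, measurable A ->
  P ((fun o => (X0 o, X0 o)) @^-1` A) = \int[mu 0%N]_(x in A) (p0 x)%:E.
Hypothesis qE : forall t, (t < T)%N -> forall (a : X t * X t * U t) A,
  measurable A ->
  P ((fun o => (f a.1.1 a.2 (W t o), fhat a.1.2 a.2 (W t o))) @^-1` A) =
  \int[mu t.+1]_(x in A) (q a x)%:E.
Hypothesis rE : forall t, (t <= T)%N -> forall (x : X t) A, measurable A ->
  P ((fun o => h x (Z t o)) @^-1` A) = \int[nu t]_(y in A) (r x y)%:E.
Context (g : strategy U Y) (mg : measurable_strategy T g).

Let traj t o := trajectory f fhat h g (X0 o) (W ^~ o) (Z ^~ o) t.

Definition used_noises t : pred (option ('I_T + 'I_T.+1)) := fun i =>
  match i with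
  | None => true
  | Some (inl j) => (j < t)%N
  | Some (inr j) => (j <= t)%N
  end.

(** The recursion through projections, so that one step of the trajectory is
    visibly a function of the previous one and of two fresh noises. *)
Lemma trajectoryS t o : traj t.+1 o =
  (let u := g (traj t o).2 in
   let x := (f (traj t o).1.1 u (W t o), fhat (traj t o).1.2 u (W t o)) in
   (x, ((traj t o).2, u, h x.1 (Z t.+1 o)))).
Proof. by rewrite /traj /=; case: trajectory => -[]. Qed.

Lemma measurable_primitive_sigma i A :
  primitive_sigma T X0 W Z i A -> measurable A.
Proof.
case: i => [[j|j]|] /= [B mB <-]; rewrite setTI -[X in measurable X]setTI.
- exact: (measurable_funP (W j)).
- exact: (measurable_funP (Z j)).
- exact: (measurable_funP X0).
Qed.

(** The three properties are proved together: the step for the conditional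
    density uses the independence of the current trajectory from the next
    noises, and adjoining these noises to it uses its measurability. *)
Lemma trajectory_invariant t : (t <= T)%N ->
  [/\ measurable_fun setT (traj t),
      independent_of_unused P (primitive_sigma T X0 W Z) (traj t)
        (used_noises t) &
      disintegrates P (mu t) (states f fhat h X0 W Z g t)
        (history f fhat h X0 W Z g t) (information_state (t := t))].
Proof.
elim: t => [_|t IH tT].
  have mX0 : measurable_fun setT X0 := measurable_funP X0.
  have mZ0 : measurable_fun setT (Z 0%N) := measurable_funP (Z 0%N).
  pose S0 o : X 0 * X 0 := (X0 o, X0 o).
  have mS0 : measurable_fun setT S0 by exact: measurable_fun_pair.
  have iX0 : independent_of_unused P (primitive_sigma T X0 W Z) X0 (pred1 None).
    exact: independent_of_unused_init.
  have iX0Z0 := independent_of_unused_adjoin measurable_primitive_sigma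
    mX0 mZ0 (used := pred1 None) (i := Some (inr ord0)) erefl isT iX0.
  have mtraj0 : measurable_fun [set: X 0 * ZT]
      (fun a => ((a.1, a.1), h a.1 a.2)).
    by apply: measurable_fun_pair; [measurable_projections|exact: mh].
  split.
  - exact: (measurableT_comp mtraj0 (measurable_fun_pair mX0 mZ0)).
  - apply: independent_of_unused_sub
      (independent_of_unused_comp mtraj0 iX0Z0) => i.
    by rewrite /= => /orP[/eqP ->|/eqP ->].
  (* The first observation is a Bayes step with a trivial conditioning variable
     and the law of the initial states as prior. *)
  - have S0tt : disintegrates P (mu 0%N) S0 (fun=> tt) (fun=> p0).
      move=> phi mphi phi0.
      rewrite (@integral_density _ _ _ P _ _ (mu 0%N) S0 p0
        (fun x => phi (x, tt)))//; last exact: measurable_fun_pair1.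
      by rewrite [RHS]integral_cst// [X in _ * X]probability_setT mule1.
    have dp0k : density_kernel (mu 0%N) (fun _ : unit => p0).
      by split=> //; have [mp0 _ _] := dp0; exact: measurableT_comp.
    have dr0k : density_kernel (nu 0%N) (fun a : X 0 * X 0 * unit => r a.1.1).
      by apply: density_kernel_comp (dr (leq0n T)); measurable_projections.
    have Y0S0 : disintegrates P (nu 0%N) (fun o => h (X0 o) (Z 0%N o))
        (fun o => (S0 o, tt)) (fun a => r a.1.1).
      apply: (disintegrates_independent (H := fun o => (S0 o, tt)) (N := Z 0%N)
        (s := fun a => h a.1.1)) => //.
      + exact: measurable_fun_pair.
      + apply: (independent_of_unused_one (i := Some (inr ord0)) erefl _
          (independent_of_unused_comp (s := fun x => ((x, x), tt))
            _ iX0)) => //.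
        by measurable_projections.
      + by apply: (measurable_uncurried (mh (leq0n T))); measurable_projections.
      + by move=> a; exact: rE.
    exact: (disintegrates_factor (s := snd) measurable_snd
      (disintegrates_bayes dr0k dp0k S0tt Y0S0)).
have [mtraj itraj SHPi] := IH (ltnW tT).
have mW : measurable_fun setT (W t) := measurable_funP (W t).
have mZ : measurable_fun setT (Z t.+1) := measurable_funP (Z t.+1).
have mgt := mg tT.
pose WI : option ('I_T + 'I_T.+1) := Some (inl (Ordinal tT)).
pose ZI : option ('I_T + 'I_T.+1) := Some (inr (Ordinal (tT : t.+1 < T.+1)%N)).
have WIP : ~~ used_noises t WI by rewrite /= ltnn.
pose F : measurableType _ := (hist Y U t * U t)%type.
pose E : measurableType _ := (X t * X t)%type.
pose E' : measurableType _ := (X t.+1 * X t.+1)%type.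
pose extend (v : E * hist Y U t) : E * F := (v.1, (v.2, g v.2)).
have mextend : measurable_fun setT extend.
  by measurable_projections; exact: measurableT_comp.
pose SH o := extend (traj t o).
have mSH : measurable_fun setT SH by exact: measurableT_comp.
have iSH := independent_of_unused_comp mextend itraj.
(* The step factors through SH, which uses no new noise, then S'H, which uses
   the disturbance, then observe, which uses the sensor noise. *)
pose advance (a : E * F) w : E' := (f a.1.1 a.2.2 w, fhat a.1.2 a.2.2 w).
have madvance : measurable_fun [set: (E * F) * WT] (fun a => advance a.1 a.2).
  apply: measurable_fun_pair.
    by apply: (measurableT_comp (mf tT)
      (g := fun a => (a.1.1.1, a.1.2.2, a.2))); measurable_projections.
  by apply: (measurableT_comp (mfhat tT)
    (g := fun a => (a.1.1.2, a.1.2.2, a.2))); measurable_projections.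
pose S'H o := (advance (SH o) (W t o), (SH o).2).
have mS'H : measurable_fun setT S'H.
  apply: measurable_fun_pair; last exact: measurableT_comp.
  exact: (measurable_uncurried madvance mSH mW).
have iSHW := independent_of_unused_adjoin measurable_primitive_sigma
  mSH mW (i := WI) erefl WIP iSH.
have madvanced : measurable_fun [set: (E * F) * WT]
    (fun a => (advance a.1 a.2, a.1.2)).
  by apply: measurable_fun_pair => //; measurable_projections.
have iS'H : independent_of_unused P (primitive_sigma T X0 W Z) S'H _ :=
  independent_of_unused_comp madvanced iSHW.
have ZIP : ~~ predU (used_noises t) (pred1 WI) ZI by rewrite /= ltnn.
have iS'HZ := independent_of_unused_adjoin measurable_primitive_sigma
  mS'H mZ (i := ZI) erefl ZIP iS'H.
pose observe (a : E' * F * ZT) : E' * (F * Y) :=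
  (a.1.1, (a.1.2, h a.1.1.1 a.2)).
have mobserve : measurable_fun setT observe.
  measurable_projections.
  by apply: (measurable_uncurried (mh tT)); measurable_projections.
have trajE : traj t.+1 = observe \o (fun o => (S'H o, Z t.+1 o)).
  by apply/funext => o; rewrite trajectoryS.
split.
- rewrite trajE; apply: (measurableT_comp mobserve).
  exact: measurable_fun_pair.
- rewrite trajE; apply: independent_of_unused_sub
    (independent_of_unused_comp mobserve iS'HZ) => i /=.
  case: i => [[j|j]|]//=; rewrite !orbF.
  + by move=> /orP[/ltnW|/eqP[->]]//=.
  + by move=> /orP[/leqW|/eqP[->]]//=.
- have -> : states f fhat h X0 W Z g t.+1 = (fun o => advance (SH o) (W t o)).
    by apply/funext => o; exact: (congr1 (fun v => (v o).1) trajE).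
  have -> : history f fhat h X0 W Z g t.+1 =
      (fun o => ((SH o).2, h (advance (SH o) (W t o)).1 (Z t.+1 o))).
    by apply/funext => o; exact: (congr1 (fun v => (v o).2) trajE).
  have mtraj1 : measurable_fun setT (fun o => (traj t o).1).
    exact: measurableT_comp.
  have mtraj2 : measurable_fun setT (fun o => (SH o).2).
    exact: measurableT_comp.
  have mh1 : measurable_fun [set: E' * ZT] (fun a => h a.1.1 a.2).
    by apply: (measurable_uncurried (mh tT)); measurable_projections.
  have dpk : density_kernel (mu t) (fun k : F => information_state k.1).
    apply: density_kernel_comp (density_kernel_information_state (ltnW tT)).
    by measurable_projections.
  have dqk : density_kernel (mu t.+1) (fun a : E * F => q (a.1, a.2.2)).
    by apply: density_kernel_comp (dq tT); measurable_projections.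
  have SHq : disintegrates P (mu t) (fun o => (traj t o).1) (fun o => (SH o).2)
      (fun k : F => information_state k.1).
    exact: (disintegrates_enlarge mgt SHPi).
  apply: (@disintegrates_one_step _ _ _ P _ _ _ _ _ _ E F E' Y WT ZT
    (mu t) (mu t.+1) (nu t.+1) (fun o => (traj t o).1) (fun o => (SH o).2)
    (W t) (Z t.+1) advance (fun x z => h x.1 z) _ _ _
    mtraj1 mtraj2 mW mZ madvance mh1
    (independent_of_unused_one (i := WI) erefl WIP iSH)
    (independent_of_unused_one (i := ZI) erefl ZIP iS'H)
    dpk dqk (dr1 tT) _ _ SHq).
  + by move=> a; exact: (qE tT (a.1, a.2.2)).
  + by move=> x; exact: (rE tT x.1).
Qed.

End nonlinear_filter.

Theorem theorem1 (R : realType) (T : nat)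
    (d : measure_display) (Omega : measurableType d) (P : probability Omega R)
    (dX : nat -> measure_display) (X : forall t, measurableType (dX t))
    (dU : nat -> measure_display) (U : forall t, measurableType (dU t))
    (dW : measure_display) (WT : measurableType dW)
    (dZ : measure_display) (ZT : measurableType dZ)
    (dY : measure_display) (Y : measurableType dY)
    (* primitive random variables *)
    (X0 : {RV P >-> X 0%N}) (W : nat -> {RV P >-> WT}) (Z : nat -> {RV P >-> ZT})
    (indep : mutually_independent P (primitive_sigma T X0 W Z))
    (* dynamics of the model and of the actual system, observation map *)
    (f fhat : forall t, X t -> U t -> WT -> X t.+1)
    (h : forall t, X t -> ZT -> Y)
    (mf : forall t, (t < T)%N ->
      measurable_fun [set: X t * U t * WT]
        (fun a : X t * U t * WT => f t a.1.1 a.1.2 a.2))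
    (mfhat : forall t, (t < T)%N ->
      measurable_fun [set: X t * U t * WT]
        (fun a : X t * U t * WT => fhat t a.1.1 a.1.2 a.2))
    (mh : forall t, (t <= T)%N ->
      measurable_fun [set: X t * ZT] (fun a : X t * ZT => h t a.1 a.2))
    (* reference measures with respect to which densities are taken *)
    (mu : forall t, {sigma_finite_measure set (X t * X t)%type -> \bar R})
    (nu : nat -> {sigma_finite_measure set Y -> \bar R})
    (* p(x_0, xhat_0), p(x_{t+1}, xhat_{t+1} | x_t, xhat_t, u_t), p(y_t | x_t) *)
    (dens_init : has_density P (mu 0%N) (fun o => (X0 o, X0 o)))
    (dens_trans : forall t, (t < T)%N ->
      has_density_kernel P (mu t.+1)
        (fun (a : X t * X t * U t) o =>
           (f t a.1.1 a.2 (W t o), fhat t a.1.2 a.2 (W t o))))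
    (dens_obs : forall t, (t <= T)%N ->
      has_density_kernel P (nu t) (fun (x : X t) o => h t x (Z t o)))
    (* feasible set of strategies *)
    (G : set (strategy U Y))
    (mG : forall g, G g -> measurable_strategy T g) :
  exists (Pi : forall t, hist Y U t -> X t * X t -> R)
         (phi : forall t, (X t * X t -> R) -> Y -> U t -> X t.+1 * X t.+1 -> R),
  [/\ (* Pi_t is the conditional density of the states, for every strategy *)
      forall g, G g -> forall t, (t <= T)%N ->
        is_conditional_density P (mu t) (states f fhat h X0 W Z g t)
          (history f fhat h X0 W Z g t) (Pi t),
      (* phi_t maps densities to densities *)
      forall t, (t < T)%N -> forall p y u,
        is_density (mu t) p -> is_density (mu t.+1) (phi t p y u),
      (* phi_t depends on a density only up to almost everywhere equality *)
      forall t, (t < T)%N -> forall p p' y u,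
        is_density (mu t) p -> is_density (mu t) p' ->
        {ae mu t, forall x, p x = p' x} ->
        {ae mu t.+1, forall x, phi t p y u x = phi t p' y u x} &
      forall t, (t < T)%N -> forall (k : hist Y U t) (u : U t) (y : Y),
        Pi t.+1 (k, u, y) = phi t (Pi t k) y u].
Proof.
have [p0 [dp0 p0E]] := dens_init.
(* The densities exist only up to the horizon; beyond it any function serves to
   make the families total. *)
have qx t : exists q : X t * X t * U t -> X t.+1 * X t.+1 -> R,
    (t < T)%N -> density_kernel (mu t.+1) q /\
      forall a A, measurable A ->
        P ((fun o => (f t a.1.1 a.2 (W t o), fhat t a.1.2 a.2 (W t o))) @^-1` A)
        = \int[mu t.+1]_(x in A) (q a x)%:E.
  have [/dens_trans[q qP]|_] := ltnP t T; first by exists q.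
  by exists (fun _ _ => 0%R).
have rx t : exists r : X t -> Y -> R,
    (t <= T)%N -> density_kernel (nu t) r /\
      forall x A, measurable A ->
        P ((fun o => h t x (Z t o)) @^-1` A) = \int[nu t]_(y in A) (r x y)%:E.
  have [/dens_obs[r rP]|_] := leqP t T; first by exists r.
  by exists (fun _ _ => 0%R).
pose q t := sval (cid (qx t)); pose r t := sval (cid (rx t)).
have qP t := svalP (cid (qx t)); have rP t := svalP (cid (rx t)).
have dq t tT : density_kernel (mu t.+1) (q t) := proj1 (qP t tT).
have dr t tT : density_kernel (nu t) (r t) := proj1 (rP t tT).
exists (information_state mu p0 q r), (filter_update mu q r); split.
- move=> g Gg t tT.
  have [mtraj _ SH] := trajectory_invariant dp0 dq dr indep mf mfhat mh p0E
    (fun t tT => proj2 (qP t tT)) (fun t tT => proj2 (rP t tT)) (mG g Gg) tT.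
  apply: is_conditional_density_disintegrates => //.
  + exact: measurableT_comp.
  + exact: measurableT_comp.
  + exact: (density_kernel_information_state dp0 dq dr).
- by move=> t tT p y u; exact: (is_density_filter_update dq dr).
- move=> t tT p p' y u dp dp' pp'.
  rewrite (filter_update_ae_eq r dq y u tT dp dp' pp').
  by apply: aeW.
- by [].
Qed.
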